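(* Let $n\ge 1$, let $V\in C([0,1];\mathbb{R}^{n\times n})$ be such that $V(x)$ is symmetric for every $x$, and let $\alpha_1,\alpha_2,\beta_1,\beta_2\in\mathbb{R}^{n\times n}$ satisfy $\operatorname{rank}[\alpha_1\ \alpha_2]=\operatorname{rank}[\beta_1\ \beta_2]=n$, $\alpha_1\alpha_2^t-\alpha_2\alpha_1^t=0$ and $\beta_1\beta_2^t-\beta_2\beta_1^t=0$. For each $s_0\in(0,1]$ there exists $\lambda_\infty=\lambda_\infty(s_0)>0$ such that for every fixed $\lambda\in(-\infty,-\lambda_\infty]$ the path $s\mapsto\Phi_s^\lambda(Y_\lambda)$ has no crossings as $s$ ranges over $[s_0,1]$. In particular, $\Phi_s^\lambda(Y_\lambda)$ has no crossings on $\Gamma_4=\{(s,\lambda): \lambda=-\lambda_\infty,\ s_0\le s\le 1\}$.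
   Context: For $\lambda\in\mathbb{R}$ and $s\in(0,1]$, $Y_\lambda$ is the ($n$-dimensional) space of $\mathbf{p}=\binom{p}{q}\in H^1(0,s)$ with values in $\mathbb{R}^{2n}$ solving $p'=q$, $q'=(V(x)-\lambda I)p$ on $[0,s]$ and satisfying $\alpha_1p(0)+\alpha_2q(0)=0$; $\Phi_s^\lambda:Y_\lambda\to\mathbb{R}^{2n}$ is the trace map $\mathbf{p}\mapsto\mathbf{p}(s)$. The target space is $\ell_1=\{\binom{p}{q}\in\mathbb{R}^{2n}:\beta_1p+\beta_2q=0\}$, equivalently the subspace spanned by the columns of $\binom{\beta_2^t}{-\beta_1^t}$. A crossing at $(s,\lambda)$ means $\Phi_s^\lambda(Y_\lambda)\cap\ell_1\ne\{0\}$. *)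

(* Defs.v *)
From HB Require Import structures.
From mathcomp Require Import all_boot all_order all_algebra.
From mathcomp Require Import all_classical all_reals all_analysis.
Set Implicit Arguments.
Unset Strict Implicit.
Unset Printing Implicit Defensive.
Import Order.TTheory GRing.Theory Num.Theory.
Import numFieldNormedType.Exports.
Local Open Scope classical_set_scope.
Local Open Scope ring_scope.

(* [H1_deriv s u g]: the scalar function u belongs to H^1(0,s), with derivative
   (class of) g in L^2(0,s). An element of H^1(0,s) is given by its absolutely
   continuous representative on [0,s], so that the traces u 0 and u s are plain
   evaluations; values of u and g outside [0,s] play no role. *)
Definition H1_deriv (R : realType) (s : R) (u g : R -> R) : Prop :=
  [/\ measurable_fun (`[0, s] : set R) g,
      (\int[lebesgue_measure]_(t in `[0%R, s]) ((g t ^+ 2)%:E) < +oo)%E &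
      forall x : R, 0 <= x <= s ->
        u x = u 0 + \int[lebesgue_measure]_(t in `[0, x]) g t].

Definition H1_deriv_vec (R : realType) (m : nat) (s : R)
    (u g : R -> 'cV[R]_m) : Prop :=
  forall i : 'I_m, H1_deriv s (fun x => u x i 0) (fun x => g x i 0).

(* A vector (p, q) of R^{2n} is a z : 'cV[R]_(n + n), with p = usubmx z and
   q = dsubmx z. The system p' = q, q' = (V - lambda I) p is an equality of
   L^2 functions, hence holds almost everywhere on [0,s]. *)
Definition Y (R : realType) (n : nat) (V : R -> 'M[R]_n) (a1 a2 : 'M[R]_n)
    (s lambda : R) : set (R -> 'cV[R]_(n + n)) :=
  [set u | (exists u' : R -> 'cV[R]_(n + n),
      H1_deriv_vec s u u' /\
      {ae lebesgue_measure, forall x : R, 0 <= x <= s ->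
         usubmx (u' x) = dsubmx (u x) /\
         dsubmx (u' x) = (V x - lambda%:M) *m usubmx (u x)}) /\
    a1 *m usubmx (u 0) + a2 *m dsubmx (u 0) = 0].

Definition trace_map (R : realType) (m : nat) (s : R)
    (u : R -> 'cV[R]_m) : 'cV[R]_m := u s.

Definition ell1 (R : realType) (n : nat) (b1 b2 : 'M[R]_n) :
    set 'cV[R]_(n + n) :=
  [set z | b1 *m usubmx z + b2 *m dsubmx z = 0].

Definition crossing (R : realType) (n : nat) (V : R -> 'M[R]_n)
    (a1 a2 b1 b2 : 'M[R]_n) (s lambda : R) : Prop :=
  (trace_map s @` Y V a1 a2 s lambda) `&` ell1 b1 b2 <> [set 0].

Definition Gamma4 (R : realType) (s0 lambda_inf : R) : set (R * R) :=
  [set sl | sl.2 = - lambda_inf /\ s0 <= sl.1 <= 1].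

(* Main.v *)
Require Import Defs.
From HB Require Import structures.
From mathcomp Require Import all_boot all_order all_algebra.
From mathcomp Require Import all_classical all_reals all_analysis.
From mathcomp Require Import measurable_realfun.
From mathcomp Require Import ring lra.
Set Implicit Arguments.
Unset Strict Implicit.
Unset Printing Implicit Defensive.
Import Order.TTheory GRing.Theory Num.Theory.
Import numFieldNormedType.Exports.
Local Open Scope classical_set_scope.
Local Open Scope ring_scope.

(** The proof is an energy argument in differential form.  Let (p, q) solve
p' = q, q' = (V - lambda) p on [0, s], with the boundary condition of alpha
at 0 and that of beta at s.  For any differentiable phi, put

  F = p.q - phi |p|^2.

Completing the square gives

  F' = |q - phi p|^2 + p.(V p) - (lambda + phi' + phi^2) |p|^2,

so F' >= |q - phi p|^2 + |p|^2 as soon as - lambda is large compared with V,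
phi' and phi^2.  On a Lagrangian plane {a1 p + a2 q = 0} the product p.q is a
quadratic form in p alone ([lagrangian_quadratic_form]), hence is bounded by
C |p|^2; the point is that C does not see q.  Taking for phi the affine function
that runs from - C at 0 to C at s makes F nonnegative at 0 and nonpositive at s.
As F is nondecreasing, it is constant, F' vanishes, and p and q vanish inside
the interval, hence also at s by continuity ([energy_rigidity]).  The slope of
phi is 2 C / s <= 2 C / s0, and this is the only place where s0 enters: it makes
the threshold

  lambda_inf = 2 C / s0 + C^2 + M + 1,  with M a bound for V on [0, 1],

uniform in s >= s0.

Elements of Y are only H^1 with the equation holding almost everywhere.  Since
the right-hand sides are continuous, the fundamental theorem of calculus
upgrades them to classical solutions ([H1_deriv_is_derive]). *)

(** * The Euclidean scalar product *)

Definition dotv (R : realType) (n : nat) (x y : 'cV[R]_n) : R :=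
  (x^T *m y) 0 0.

Section Dotv.
Context (R : realType) (n : nat).
Implicit Types (x y : 'cV[R]_n) (S : 'M[R]_n).

Lemma dotvE x y : dotv x y = \sum_i x i 0 * y i 0.
Proof. by rewrite /dotv mxE; apply: eq_bigr => i _; rewrite mxE. Qed.

Lemma dotv_ge0 x : 0 <= dotv x x.
Proof. by rewrite dotvE sumr_ge0// => i _; rewrite -expr2 sqr_ge0. Qed.

Lemma sqr_coord_le_dotv x i : x i 0 ^+ 2 <= dotv x x.
Proof.
rewrite dotvE (bigD1 i)//= expr2 lerDl sumr_ge0// => j _.
by rewrite -expr2 sqr_ge0.
Qed.

Lemma dotv_eq0 x : dotv x x <= 0 -> x = 0.
Proof.
move=> x0; apply/matrixP => i j; rewrite ord1 mxE; apply/eqP.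
by rewrite -sqrf_eq0 eq_le sqr_ge0 andbT (le_trans (sqr_coord_le_dotv x i)).
Qed.

(** The sum of the absolute values of the entries is a crude operator norm; any
constant does here, and this one bounds V by continuity of its entries. *)
Lemma dotv_mulmx_le S x :
  `|dotv x (S *m x)| <= (\sum_i \sum_j `|S i j|) * dotv x x.
Proof.
rewrite [in leLHS]dotvE mulr_suml (le_trans (ler_norm_sum _ _ _))// ler_sum//.
move=> i _; rewrite mxE mulr_sumr mulr_suml.
rewrite (le_trans (ler_norm_sum _ _ _))// ler_sum// => j _.
rewrite mulrCA normrM ler_wpM2l// ler_norml.
have := sqr_coord_le_dotv x i; have := sqr_coord_le_dotv x j.
have := sqr_ge0 (x i 0 - x j 0); have := sqr_ge0 (x i 0 + x j 0).
by move=> *; apply/andP; split; nra.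
Qed.

(** The completion of the square behind the energy estimate: the left-hand side
is the derivative of p.q - phi |p|^2 along a solution of the system at a point
where p = x, q = y, V = S, phi = f and phi' = k. *)
Lemma dotv_energy S x y (f l k : R) :
  dotv y y + dotv x ((S - l%:M) *m x)
    - (k * dotv x x + f * (dotv x y + dotv x y)) =
  dotv (y - f *: x) (y - f *: x) + dotv x (S *m x)
    - (l + k + f ^+ 2) * dotv x x.
Proof.
rewrite mulmxBl mul_scalar_mx !dotvE !mulr_sumr.
rewrite -!big_split/= !mulr_sumr -!big_split/= -!sumrB.
by apply: eq_bigr => i _; rewrite !mxE; ring.
Qed.

End Dotv.

(** * Lagrangian planes *)

(** Read on row vectors, the plane a1 p + a2 q = 0 is the left kernel K of
(a1^T; a2^T), of dimension 2n - n.  The Lagrangian condition says that the rows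
of L = (a2, - a1) lie in K, and L has rank n like (a1, a2), so L spans K. *)
Lemma lagrangian_parametrization (R : realType) (n : nat) (a1 a2 : 'M[R]_n)
    (p q : 'cV[R]_n) :
  \rank (row_mx a1 a2) = n -> a1 *m a2^T - a2 *m a1^T = 0 ->
  a1 *m p + a2 *m q = 0 ->
  exists c : 'cV[R]_n, p = a2^T *m c /\ q = - (a1^T *m c).
Proof.
move=> rka lagr apq.
pose K := kermx (col_mx a1^T a2^T).
pose L := row_mx a2 (- a1).
have rkT : \rank (col_mx a1^T a2^T) = n by rewrite -tr_row_mx mxrank_tr.
have LK : (L <= K)%MS.
  apply/sub_kermxP; rewrite mul_row_col mulNmx.
  by rewrite -lagr -[LHS]opprK opprB lagr oppr0.
have rkL : \rank L = n.
  apply/eqP; rewrite -[_ == _]/(row_free L) -kermx_eq0.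
  apply/eqP; set k := kermx L.
  have : k *m L = 0 by rewrite mulmx_ker.
  rewrite mul_mx_row mulmxN -[RHS]row_mx0 => /eq_row_mx[k2 /eqP].
  rewrite oppr_eq0 => /eqP k1.
  have : k *m row_mx a1 a2 = 0 by rewrite mul_mx_row k1 k2 row_mx0.
  have : row_free (row_mx a1 a2) by rewrite /row_free rka.
  move=> /row_freeP[B aB] /(congr1 (mulmx^~ B)).
  by rewrite -mulmxA aB mulmx1 mul0mx.
have KL : (K <= L)%MS.
  have /mxrank_leqif_sup/leqifP := LK.
  by rewrite mxrank_ker rkT rkL addnK; case: ifP; rewrite ?ltnn.
have : (row_mx p^T q^T <= K)%MS.
  apply/sub_kermxP; rewrite mul_row_col -!trmx_mul -linearD/= apq.
  by rewrite trmx0.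
move=> /submx_trans/(_ KL)/submxP[d].
rewrite mul_mx_row mulmxN => /eq_row_mx[pd qd].
exists d^T; split; apply/trmx_inj; first by rewrite pd trmx_mul !trmxK.
by rewrite qd linearN/= trmx_mul !trmxK.
Qed.

(** With p = a2^T c and q = - a1^T c one has p.q = - c.(B c), where
B = a1 a2^T is symmetric.  B factors on the right through A = a2^T, hence by
symmetry on the left through A^T, and B = A^T S' A for some S': the form c.(B c)
depends on p = A c only.  The pseudo-inverse G of A provides S' = G^T B G
without choosing a complement of the kernel of A. *)
Lemma lagrangian_quadratic_form (R : realType) (n : nat) (a1 a2 : 'M[R]_n) :
  \rank (row_mx a1 a2) = n -> a1 *m a2^T - a2 *m a1^T = 0 ->
  exists S : 'M[R]_n, forall p q : 'cV[R]_n,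
    a1 *m p + a2 *m q = 0 -> dotv p q = dotv p (S *m p).
Proof.
move=> rka lagr.
pose B := a1 *m a2^T; pose G := pinvmx a2^T.
have BT : B^T = B.
  by rewrite /B trmx_mul trmxK; apply/esym/eqP; rewrite -subr_eq0 lagr.
have BGA : B = B *m G *m a2^T.
  by rewrite mulmxKpV// submxMl.
exists (- (G^T *m B *m G)) => p q.
move=> /(lagrangian_parametrization rka lagr)[c [-> ->]].
have BE : B = a2 *m G^T *m B *m G *m a2^T.
  have Ba2 : B = a2 *m G^T *m B.
    rewrite -[LHS]BT [in LHS]BGA trmx_mul [(B *m G)^T]trmx_mul.
    by rewrite BT trmxK mulmxA.
  by rewrite -[X in X *m G]Ba2 -BGA.
rewrite /dotv; congr (_ _ 0 0).
rewrite mulmxN mulNmx mulmxN; congr (- _).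
have a21 : a2 *m a1^T = B by rewrite -BT trmx_mul trmxK.
by rewrite trmx_mul trmxK !mulmxA -(mulmxA c^T a2) a21 [in LHS]BE !mulmxA.
Qed.

(** * Regularity of functions in H^1 *)

Section H1_regularity.
Context (R : realType).
Local Notation mu := (@lebesgue_measure R).
Implicit Types (s : R) (u g h : R -> R).

Lemma H1_deriv_integrable s u g : H1_deriv s u g ->
  mu.-integrable `[0, s] (EFin \o g).
Proof.
move=> [mg g2 _].
have int1 : mu.-integrable `[0, s] (EFin \o cst (1 : R)).
  apply: continuous_compact_integrable; first exact: segment_compact.
  by apply: continuous_subspaceT => x; exact: cvg_cst.
have intg2 : mu.-integrable `[0, s] (EFin \o (fun x => g x ^+ 2)).
  apply/integrableP; split.
    exact/measurable_EFinP/measurable_funX.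
  rewrite (_ : integral _ _ _ = \int[mu]_(t in `[0%R, s]) (g t ^+ 2)%:E)%E//.
  by apply: eq_integral => x _ /=; rewrite ger0_norm// sqr_ge0.
(* |g| <= 1 + g^2, and the interval has finite measure. *)
have : mu.-integrable `[0, s] (EFin \o (fun x => 1 + g x ^+ 2)).
  by apply: (integrableD _ int1 intg2).
apply: le_integrable => //.
  exact/measurable_EFinP.
move=> x _ /=; rewrite lee_fin [leRHS]ger0_norm; last first.
  by rewrite addr_ge0// sqr_ge0.
rewrite ler_norml; have := sqr_ge0 (g x - 1); have := sqr_ge0 (g x + 1).
by move=> *; apply/andP; split; nra.
Qed.

Lemma H1_deriv_continuous s u g : 0 <= s -> H1_deriv s u g ->
  {within `[0, s], continuous u}.
Proof.
move=> s0 H; have intg := H1_deriv_integrable H.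
have cI := parameterized_integral_continuous s0 intg.
case: H => _ _ uE.
have : {within `[0, s],
    continuous (fun x => u 0 + parameterized_integral mu 0 x g)}.
  by move=> x; apply: cvgD; [exact: cvg_cst|exact: cI].
apply: subspace_eq_continuous => x; rewrite inE/= in_itv/= => xs.
by rewrite [RHS]uE.
Qed.

(** Replacing the weak derivative g by an almost everywhere equal continuous
function h does not change the integral defining u, to which the fundamental
theorem of calculus then applies at every interior point. *)
Lemma H1_deriv_is_derive s u g h : H1_deriv s u g ->
  {ae mu, forall x, 0 <= x <= s -> g x = h x} ->
  {within `[0, s], continuous h} ->
  forall x, 0 < x < s -> is_derive x 1 u (h x).
Proof.
move=> H gh ch x /andP[x0 xs].
have s0 : 0 < s := lt_trans x0 xs.
case: H => mg _ uE.
have inth : mu.-integrable `[0, s] (EFin \o h).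
  by apply: continuous_compact_integrable ch; exact: segment_compact.
have chx : {for x, continuous h}.
  have /(continuous_within_itvP _ s0)[+ _ _] := ch.
  by apply; rewrite in_itv/= x0.
have [dh dhE] := continuous_FTC1_closed xs inth x0 chx.
set I := (fun y : R => _) in dh dhE.
have : is_derive x 1 (cst (u 0) + I) (h x).
  have dI : is_derive x 1 I (h x) by rewrite -dhE derive1E; exact/derivableP.
  by rewrite -[h x]add0r; exact: is_deriveD.
apply: near_eq_is_derive; near=> y.
have ys : 0 <= y <= s.
  rewrite !ltW//; near: y; [exact: lt_nbhsl|exact: lt_nbhsr].
rewrite /= (uE _ ys); congr (_ + _); rewrite /I /Rintegral; congr fine.
have sub : `[0, y] `<=` `[0, s].
  by apply: subset_itvl; rewrite bnd_simp; case/andP: ys.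
apply: ae_eq_integral => //.
- apply/measurable_EFinP; apply: measurable_funS sub _ => //.
  by case/integrableP: inth => /measurable_EFinP.
- apply/measurable_EFinP; exact: measurable_funS sub _.
- move: gh; apply: filterS; first exact: (ae_filter_ringOfSetsType mu).
  move=> z + zy /=.
  by move=> ->//; have := sub _ zy; rewrite /= in_itv.
Unshelve. all: by end_near. Qed.

End H1_regularity.

(** * One-variable calculus *)

Lemma within_continuous_coord (R : realType) (m n : nat) (A : set R)
    (V : R -> 'M[R]_(m, n)) i j :
  {within A, continuous V} -> {within A, continuous (fun x => V x i j)}.
Proof.
move=> cV x.
by apply: (cvg_comp V (fun B : 'M[R]_(m, n) => B i j) (cV x));
  exact: coord_continuous.
Qed.

Section Calculus.
Context (R : realType) (n : nat).
Implicit Types (f g : R -> 'cV[R]_n).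

Lemma within_continuous_sum (A : set R) (F : 'I_n -> R -> R) :
  (forall i, {within A, continuous (F i)}) ->
  {within A, continuous (fun x => \sum_i F i x)}.
Proof.
by move=> cF x; apply: cvg_big => [|i _]; [exact: add_continuous|exact: cF].
Qed.

Lemma within_continuousM (A : set R) (F G : R -> R) :
  {within A, continuous F} -> {within A, continuous G} ->
  {within A, continuous (fun x => F x * G x)}.
Proof. by move=> cF cG x; apply: cvgM; [exact: cF|exact: cG]. Qed.

Lemma within_continuous_dotv (A : set R) f g :
  (forall i, {within A, continuous (fun x => f x i 0)}) ->
  (forall i, {within A, continuous (fun x => g x i 0)}) ->
  {within A, continuous (fun x => dotv (f x) (g x))}.
Proof.
move=> cf cg; under eq_fun do rewrite dotvE.
by apply: within_continuous_sum => i; exact: within_continuousM.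
Qed.

Lemma within_continuous_mulmx (A : set R) (W : R -> 'M[R]_n) f i :
  (forall i j, {within A, continuous (fun x => W x i j)}) ->
  (forall i, {within A, continuous (fun x => f x i 0)}) ->
  {within A, continuous (fun x => (W x *m f x) i 0)}.
Proof.
move=> cW cf; under eq_fun do rewrite mxE.
by apply: within_continuous_sum => j; exact: within_continuousM.
Qed.

Lemma is_derive_dotv f g (x : R) (df dg : 'cV[R]_n) :
  (forall i, is_derive x 1 (fun y => f y i 0) (df i 0)) ->
  (forall i, is_derive x 1 (fun y => g y i 0) (dg i 0)) ->
  is_derive x 1 (fun y => dotv (f y) (g y)) (dotv df (g x) + dotv (f x) dg).
Proof.
move=> Df Dg.
have -> : (fun y => dotv (f y) (g y)) =
    \sum_i (((fun y => f y i 0) : R -> R) * (fun y => g y i 0)).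
  by apply/funext => y; rewrite dotvE fct_sumE.
rewrite !dotvE -big_split/=.
apply: is_derive_sum => i; apply: is_derive_eq.
by rewrite /= addrC; congr (_ + _); rewrite mulrC.
Qed.

Lemma within_continuous_itv_endpoint (s c : R) (f : R -> R) : 0 < s ->
  {within `[0, s], continuous f} -> (forall x, 0 < x < s -> f x = c) -> f s = c.
Proof.
move=> s0 cf fc; have /(continuous_within_itvP _ s0)[_ _ fs] := cf.
have fsc : f x @[x --> s^'-] --> c.
  apply: cvg_near_cst; near=> x; apply: fc; apply/andP; split.
    by near: x; exact: nbhs_left_gt.
  by near: x; exact: nbhs_left_lt.
exact: cvg_unique fs fsc.
Unshelve. all: by end_near. Qed.

(** A nondecreasing function that does not end above its initial value is
constant. *)
Lemma derive_ge0_eq0 (s : R) (F dF : R -> R) : 0 < s ->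
  {within `[0, s], continuous F} ->
  (forall x, 0 < x < s -> is_derive x 1 F (dF x)) ->
  (forall x, 0 < x < s -> 0 <= dF x) ->
  F s <= F 0 -> forall x, 0 < x < s -> dF x = 0.
Proof.
move=> s0 cF DF dF0 Fs0 x x0s.
have le : forall y z, 0 <= y -> y <= z -> z <= s -> F y <= F z.
  apply: ger0_derive1_ndecr cF => y; rewrite in_itv/= => ys.
    by have [] := DF _ ys.
  by rewrite derive1E (@derive_val _ _ _ _ _ _ _ (DF _ ys)) dF0.
have : is_derive x 1 (cst (F 0)) (dF x).
  apply: near_eq_is_derive (DF x x0s).
  have : x \in `]0, s[ by rewrite in_itv.
  move/near_in_itvoo; apply: filterS => y; rewrite in_itv/= => /andP[y0 ys].
  apply/eqP; rewrite eq_le (le_trans (le _ _ _ _ _) Fs0) ?le//=; exact: ltW.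
by move=> dc; rewrite -(@derive_val _ _ _ _ _ _ _ dc) derive_cst.
Qed.

End Calculus.

(** * The energy estimate *)

(** The two inequalities at 0 and s are the only trace of the boundary
conditions.  The estimate of F' has to keep both |q - phi p|^2 and a positive
multiple of |p|^2, so that F' = 0 forces p = 0 and then q = 0; the summand 1 in
the last hypothesis provides that multiple. *)
Lemma energy_rigidity (R : realType) (n : nat) (s C M l : R)
    (p q : R -> 'cV[R]_n) (W : R -> 'M[R]_n) :
  0 < s -> 0 <= C ->
  (forall i, {within `[0, s], continuous (fun x => p x i 0)}) ->
  (forall i, {within `[0, s], continuous (fun x => q x i 0)}) ->
  (forall x, 0 < x < s ->
     forall i, is_derive x 1 (fun y => p y i 0) (q x i 0)) ->
  (forall x, 0 < x < s -> forall i,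
     is_derive x 1 (fun y => q y i 0) (((W x - l%:M) *m p x) i 0)) ->
  (forall x, 0 < x < s ->
     - (M * dotv (p x) (p x)) <= dotv (p x) (W x *m p x)) ->
  - (C * dotv (p 0) (p 0)) <= dotv (p 0) (q 0) ->
  dotv (p s) (q s) <= C * dotv (p s) (p s) ->
  l + 2 * C / s + C ^+ 2 + M + 1 <= 0 ->
  p s = 0 /\ q s = 0.
Proof.
move=> s0 C0 cp cq Dp Dq Wb bc0 bcs hl.
pose k := 2 * C / s.
(* The affine function with values - C at 0 and C at s. *)
pose phi x := k * x - C.
have phi0 : phi 0 = - C by rewrite /phi mulr0 sub0r.
have phis : phi s = C by rewrite /phi /k; field; exact: lt0r_neq0.
have phi2 x : 0 < x < s -> phi x ^+ 2 <= C ^+ 2.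
  move=> /andP[x0 xs]; have k0 : 0 <= k by rewrite /k divr_ge0 ?mulr_ge0// ltW.
  have : k * x <= k * s by rewrite ler_wpM2l// ltW.
  have -> : k * s = 2 * C by rewrite /k divfK// lt0r_neq0.
  have : 0 <= k * x by rewrite mulr_ge0// ltW.
  by rewrite /phi; nra.
have Dphi (x : R) : is_derive x 1 phi k.
  have -> : phi = k \*: id - cst C by apply/funext.
  by apply: is_derive_eq; rewrite subr0 [LHS]mulr1.
pose F := (fun x => dotv (p x) (q x)) - phi * (fun x => dotv (p x) (p x)).
pose dF x := dotv (q x) (q x) + dotv (p x) ((W x - l%:M) *m p x)
    - (k * dotv (p x) (p x)
       + phi x * (dotv (p x) (q x) + dotv (p x) (q x))).
have DF x : 0 < x < s -> is_derive x 1 F (dF x).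
  move=> xs.
  have D1 := is_derive_dotv (Dp _ xs) (Dq _ xs).
  have D2 := is_derive_dotv (Dp _ xs) (Dp _ xs).
  apply: is_derive_eq; rewrite /dF; congr (_ - _); rewrite addrC.
  congr (_ + _); first exact: mulrC.
  congr (_ * (_ + _)); rewrite !dotvE; apply: eq_bigr => i _; exact: mulrC.
have cF : {within `[0, s], continuous F}.
  apply: within_continuousB; first exact: within_continuous_dotv.
  apply: within_continuousM; last exact: within_continuous_dotv.
  apply: continuous_subspaceT => x; apply: differentiable_continuous.
  by apply/derivable1_diffP; have [] := Dphi x.
have dF_ge x : 0 < x < s ->
    dotv (q x - phi x *: p x) (q x - phi x *: p x) + dotv (p x) (p x) <= dF x.
  move=> xs; rewrite /dF dotv_energy -addrA lerD2l.
  have := Wb _ xs; have := phi2 _ xs; have := dotv_ge0 (p x).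
  by rewrite -/k in hl; nra.
have dF0 : forall x, 0 < x < s -> dF x = 0.
  apply: (derive_ge0_eq0 s0 cF DF) => [x xs|].
    by rewrite (le_trans _ (dF_ge _ xs))// addr_ge0// dotv_ge0.
  rewrite /F !fctE phi0 phis mulNr opprK (@le_trans _ _ 0)//.
    by rewrite subr_le0.
  by rewrite -lerBlDr sub0r.
have pq0 x : 0 < x < s -> p x = 0 /\ q x = 0.
  move=> xs; have := dF_ge _ xs; rewrite dF0// => pq.
  have px : p x = 0.
    by apply: dotv_eq0; rewrite (le_trans _ pq)// lerDr dotv_ge0.
  split=> //; have := pq; rewrite px scaler0 subr0 => qq.
  by apply: dotv_eq0; rewrite (le_trans _ qq)// lerDl dotv_ge0.
split; apply/matrixP => i j; rewrite ord1 mxE.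
  apply: (within_continuous_itv_endpoint s0 (cp i)) => x /pq0[-> _].
  by rewrite mxE.
apply: (within_continuous_itv_endpoint s0 (cq i)) => x /pq0[_ ->].
by rewrite mxE.
Qed.

(** * Absence of crossings *)

Lemma mx_entry_bounded (R : realType) (n : nat) (V : R -> 'M[R]_n) :
  {within `[0, 1], continuous V} ->
  exists M : R, forall x, 0 <= x <= 1 -> \sum_i \sum_j `|V x i j| <= M.
Proof.
move=> cV.
have cS : {within `[0, 1], continuous (fun x => \sum_i \sum_j `|V x i j|)}.
  apply: within_continuous_sum => i; apply: within_continuous_sum => j x.
  by apply: cvg_norm; exact: within_continuous_coord.
have [c _ cM] := EVT_max ler01 cS.
by exists (\sum_i \sum_j `|V c i j|) => x x01; apply: cM; rewrite in_itv.
Qed.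

(** The absence of a crossing is the equality of an intersection with {0}, so
0 must be shown to be a trace, too. *)
Lemma zero_in_Y (R : realType) (n : nat) (V : R -> 'M[R]_n) (a1 a2 : 'M[R]_n)
  (s lambda : R) : Y V a1 a2 s lambda (fun=> 0).
Proof.
split; last by rewrite !linear0 addr0.
exists (fun=> 0); split.
  move=> i /=; have -> : (fun _ : R => (0 : 'cV[R]_(n + n)) i 0) = cst 0.
    by apply/funext => x; rewrite mxE.
  split; first exact: measurable_cst.
  - rewrite (eq_integral (cst 0%E)); first by rewrite integral0 ltry.
    by move=> x _; rewrite /= expr0n.
  - by move=> x _; rewrite add0r /Rintegral integral0.
by apply: aeW => x _; rewrite !linear0.
Qed.

Theorem lemma3p12 (R : realType) (n : nat) (hn : (1 <= n)%N)
    (V : R -> 'M[R]_n) (a1 a2 b1 b2 : 'M[R]_n)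
    (V_cont : {within (`[0, 1] : set R), continuous V})
    (V_sym : forall x : R, 0 <= x <= 1 -> (V x)^T = V x)
    (rank_a : \rank (row_mx a1 a2) = n)
    (rank_b : \rank (row_mx b1 b2) = n)
    (lagr_a : a1 *m a2^T - a2 *m a1^T = 0)
    (lagr_b : b1 *m b2^T - b2 *m b1^T = 0)
    (s0 : R) (hs0 : 0 < s0 <= 1) :
  exists lambda_inf : R,
    [/\ 0 < lambda_inf,
        forall lambda : R, lambda <= - lambda_inf ->
          forall s : R, s0 <= s <= 1 -> ~ crossing V a1 a2 b1 b2 s lambda &
        forall s lambda : R, Gamma4 s0 lambda_inf (s, lambda) ->
          ~ crossing V a1 a2 b1 b2 s lambda].
Proof.
have [Sa SaP] := lagrangian_quadratic_form rank_a lagr_a.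
have [Sb SbP] := lagrangian_quadratic_form rank_b lagr_b.
have [M MP] := mx_entry_bounded V_cont.
pose nrm (S : 'M[R]_n) : R := \sum_i \sum_j `|S i j|.
have nrm_ge0 S : 0 <= nrm S by do 2![rewrite sumr_ge0// => ? _].
(* One constant for both ends, so that phi may run from - C to C. *)
pose C := nrm Sa + nrm Sb.
have C0 : 0 <= C by rewrite addr_ge0.
have M0 : 0 <= M.
  by rewrite (le_trans (nrm_ge0 (V 0)))// MP// lexx ler01.
case/andP: hs0 => s0_gt0 _.
pose L := 2 * C / s0 + C ^+ 2 + M + 1.
have L0 : 0 < L.
  by rewrite ltr_wpDl// !addr_ge0// ?sqr_ge0// divr_ge0 ?mulr_ge0// ltW.
suff main lambda : lambda <= - L -> forall s, s0 <= s <= 1 ->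
    ~ crossing V a1 a2 b1 b2 s lambda.
  by exists L; split=> // s lambda [/= -> ss]; exact: main.
move=> lamL s /andP[s0s s1]; apply; rewrite eqEsubset; split; last first.
  move=> _ ->; split; last by rewrite /ell1/= !linear0 addr0.
  by exists (fun=> 0) => //; exact: zero_in_Y.
move=> _ [[u [[u' [Hu ode]] bca] <-] bcb].
have s_gt0 : 0 < s := lt_le_trans s0_gt0 s0s.
pose p x := usubmx (u x); pose q x := dsubmx (u x).
have pE i : (fun x => p x i 0) = (fun x => u x (lshift n i) 0).
  by apply/funext => x; rewrite mxE.
have qE i : (fun x => q x i 0) = (fun x => u x (rshift n i) 0).
  by apply/funext => x; rewrite mxE.
have cu i := H1_deriv_continuous (ltW s_gt0) (Hu i).
have cp i : {within `[0, s], continuous (fun x => p x i 0)}.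
  by rewrite pE; exact: cu.
have cq i : {within `[0, s], continuous (fun x => q x i 0)}.
  by rewrite qE; exact: cu.
have ss01 : `[0, s] `<=` `[0, 1] by apply: subset_itvl; rewrite bnd_simp.
have cW i j : {within `[0, s], continuous (fun x => (V x - lambda%:M) i j)}.
  have -> : (fun x => (V x - lambda%:M) i j) =
      (fun x => V x i j - (lambda%:M : 'M[R]_n) i j).
    by apply/funext => x; rewrite !mxE.
  move=> x; apply: cvgB; last exact: cvg_cst.
  exact/within_continuous_coord/(continuous_subspaceW ss01 V_cont).
have ae := ae_filter_ringOfSetsType (@lebesgue_measure R).
have Dp x : 0 < x < s -> forall i, is_derive x 1 (fun y => p y i 0) (q x i 0).
  move=> xs i; rewrite pE.
  apply: (H1_deriv_is_derive (Hu _) _ (cq i)) xs.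
  apply: filterS ode => y + ys => /(_ ys)[+ _].
  by move=> /(congr1 (fun z : 'cV[R]_n => z i 0)); rewrite mxE.
have Dq x : 0 < x < s -> forall i,
    is_derive x 1 (fun y => q y i 0) (((V x - lambda%:M) *m p x) i 0).
  move=> xs i; rewrite qE.
  have ch : {within `[0, s],
      continuous (fun y => ((V y - lambda%:M) *m p y) i 0)}.
    exact: within_continuous_mulmx.
  apply: (H1_deriv_is_derive (Hu _) _ ch) xs.
  apply: filterS ode => y + ys => /(_ ys)[_].
  by move=> /(congr1 (fun z : 'cV[R]_n => z i 0)); rewrite mxE.
have [ps qs] : p s = 0 /\ q s = 0.
  apply: (@energy_rigidity _ _ s C M lambda p q V) => //.
  - move=> x /andP[x0 xs]; have := dotv_mulmx_le (V x) (p x).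
    rewrite ler_norml => /andP[h _]; apply: le_trans h.
    by rewrite lerN2 ler_wpM2r ?dotv_ge0 ?MP// !ltW// (lt_le_trans xs).
  - rewrite (SaP _ (q 0))//; have := dotv_mulmx_le Sa (p 0).
    rewrite ler_norml => /andP[h _]; apply: le_trans h.
    by rewrite lerN2 ler_wpM2r ?dotv_ge0// lerDl.
  - rewrite (SbP _ (q s))//; have := dotv_mulmx_le Sb (p s).
    rewrite ler_norml => /andP[_ h]; apply: (le_trans h).
    by rewrite ler_wpM2r ?dotv_ge0// lerDr.
  - have : 2 * C / s <= 2 * C / s0.
      by rewrite ler_wpM2l ?mulr_ge0// lef_pV2.
    by rewrite /L in lamL; lra.
by rewrite /= /trace_map -[LHS]vsubmxK [usubmx _]ps [dsubmx _]qs col_mx0.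
Qed.
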